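(* Let $\mathbb{E}$ be a finitely complete stably $\mathbb P_{\mathbb E}$-decomposable category. If $\mathbb{E}$ is protomodular, then it is strongly protomodular.
   Context: Extremal decompositions. Let $\Theta$ be a class of morphisms in a category $\mathbb{D}$ and $v:U\rightarrowtail T$ a monomorphism. A decomposition $v=w.u$ with $u:U\to X$ in $\Theta$ is $\Theta$-extremal when for any other decomposition $v=w'.u'$ with $u':U\to X'$ in $\Theta$, there is a unique $t:X'\to X$ with $w.t=w'$ and $t.u'=u$. $\mathbb{D}$ has stably $\Theta$-extremal decompositions of monomorphisms when any monomorphism has a $\Theta$-extremal decomposition and these are stable under pullback along maps in $\Theta$. Points. $\mathrm{Pt}\,\mathbb{E}$ is the category whose objects are the split epimorphisms $(f,s):X\rightleftarrows Y$, $f.s=1_Y$, with chosen splitting, and whose maps $(y,x):(f',s')\to(f,s)$ are pairs with $f.x=y.f'$ and $x.s'=s.y$. $\mathbb P_{\mathbb E}:\mathrm{Pt}\,\mathbb E\to\mathbb E$ sends $(f,s)$ to the codomain $Y$ of $f$; its fibre over $Y$ is $\mathrm{Pt}_Y\mathbb E$; $(y,x)$ is $\mathbb P_{\mathbb E}$-cartesian iff $f.x=y.f'$ is a pullback square. $\mathbb{E}$ is stably $\mathbb P_{\mathbb E}$-decomposable when $\mathrm{Pt}\,\mathbb E$ has stably $\Theta$-extremal decompositions of monomorphisms for $\Theta$ the class of $\mathbb P_{\mathbb E}$-cartesian maps. A monomorphism $u:U\rightarrowtail X$ in a finitely complete category is normal to an equivalence relation $R$ on $X$ when $u^{-1}(R)=\nabla_U$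 (the indiscrete relation $U\times U$ on $U$) and the induced internal functor $\nabla_U\to R$ is a discrete fibration (the square formed with the first projections $p_0:U\times U\to U$ and $d_0:R\to X$ is a pullback); it is normal when it is normal to some equivalence relation. $\mathbb{E}$ is protomodular when every base-change functor $h^*:\mathrm{Pt}_Y\mathbb E\to \mathrm{Pt}_{Y'}\mathbb E$ (pulling back along $h:Y'\to Y$) is conservative; it is strongly protomodular when, in addition, every such $h^*$ reflects normal monomorphisms. *)

(* Defs.v *)
From Stdlib Require Import FinFun ProofIrrelevance Relation_Definitions.

Set Implicit Arguments.
Unset Strict Implicit.
Unset Printing Implicit Defensive.

Declare Scope cat_scope.
Delimit Scope cat_scope with cat.
Local Open Scope cat_scope.

(** * Categories, functors, finite limits *)

Record category := Category {
  ob :> Type;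
  hom : ob -> ob -> Type;
  idm : forall a, hom a a;
  comp : forall a b c, hom b c -> hom a b -> hom a c;
  comp_idl : forall a b (f : hom a b), comp (idm b) f = f;
  comp_idr : forall a b (f : hom a b), comp f (idm a) = f;
  comp_assoc : forall a b c d (h : hom c d) (g : hom b c) (f : hom a b),
    comp h (comp g f) = comp (comp h g) f }.

Arguments hom {_} _ _.
Arguments idm {_} _.
Arguments comp {_ _ _ _} _ _.
Notation "g ∘ f" := (comp g f) (at level 40, left associativity) : cat_scope.

Record functor (C D : category) := Functor {
  fobj :> C -> D;
  fmap : forall a b : C, hom a b -> hom (fobj a) (fobj b);
  fmap_id : forall a : C, fmap (idm a) = idm (fobj a);
  fmap_comp : forall (a b c : C) (g : hom b c) (f : hom a b),
    fmap (g ∘ f) = fmap g ∘ fmap f }.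

Arguments fmap {_ _} _ {_ _} _.

Definition is_mono (C : category) (a b : C) (f : hom a b) : Prop :=
  forall (z : C) (g h : hom z a), f ∘ g = f ∘ h -> g = h.

Definition is_iso (C : category) (a b : C) (f : hom a b) : Prop :=
  exists g : hom b a, g ∘ f = idm a /\ f ∘ g = idm b.

Definition conservative (C D : category) (F : functor C D) : Prop :=
  forall (a b : C) (f : hom a b), is_iso (fmap F f) -> is_iso f.

(** The square [f ∘ p = g ∘ q] is a pullback. *)
Definition is_pullback (C : category) (p0 a b c : C)
    (p : hom p0 a) (q : hom p0 b) (f : hom a c) (g : hom b c) : Prop :=
  f ∘ p = g ∘ q /\
  forall (z : C) (x : hom z a) (y : hom z b), f ∘ x = g ∘ y ->
    exists! t : hom z p0, p ∘ t = x /\ q ∘ t = y.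

Definition is_product (C : category) (p0 a b : C)
    (p : hom p0 a) (q : hom p0 b) : Prop :=
  forall (z : C) (x : hom z a) (y : hom z b),
    exists! t : hom z p0, p ∘ t = x /\ q ∘ t = y.

Definition is_cone (J C : category) (D : functor J C) (z : C)
    (c : forall j, hom z (D j)) : Prop :=
  forall (i j : J) (a : hom i j), fmap D a ∘ c i = c j.

Record limit (J C : category) (D : functor J C) := Limit {
  lim_ob : C;
  lim_proj : forall j, hom lim_ob (D j);
  lim_cone : is_cone lim_proj;
  lim_med : forall (z : C) (c : forall j, hom z (D j)), is_cone c -> hom z lim_ob;
  lim_medP : forall z c (hc : @is_cone J C D z c) j, lim_proj j ∘ lim_med hc = c j;
  lim_uniq : forall (z : C) (s t : hom z lim_ob),
    (forall j, lim_proj j ∘ s = lim_proj j ∘ t) -> s = t }.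

Definition finite_category (J : category) : Prop :=
  Finite J /\ forall i j : J, Finite (hom i j).

(** Finite completeness comes with a choice of limits; the choice is what
    makes the base-change functors below actual functors. *)
Definition finitely_complete (C : category) : Type :=
  forall J : category, finite_category J -> forall D : functor J C, limit D.

(** * Chosen pullbacks, as limits over the walking cospan *)

Inductive cospan_ob : Set := cs_left | cs_right | cs_tip.

Definition cospan_hom (i j : cospan_ob) : Set :=
  match i, j with
  | cs_left, cs_left | cs_right, cs_right | cs_tip, cs_tip
  | cs_left, cs_tip | cs_right, cs_tip => unit
  | _, _ => Empty_set
  end.

Definition cospan_id (i : cospan_ob) : cospan_hom i i :=
  match i with cs_left | cs_right | cs_tip => tt end.

Definition cospan_comp (i j k : cospan_ob) :
  cospan_hom j k -> cospan_hom i j -> cospan_hom i k.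
Proof. destruct i, j, k; simpl; intros [] []; exact tt. Defined.

Lemma cospan_hom_irr (i j : cospan_ob) (a b : cospan_hom i j) : a = b.
Proof. destruct i, j, a, b; reflexivity. Qed.

Definition cospan : category :=
  @Category cospan_ob cospan_hom cospan_id cospan_comp
    (fun _ _ _ => cospan_hom_irr _ _) (fun _ _ _ => cospan_hom_irr _ _)
    (fun _ _ _ _ _ _ _ => cospan_hom_irr _ _).

Lemma cospan_finite : finite_category cospan.
Proof.
  split.
  - exists (cs_left :: cs_right :: cs_tip :: nil)%list; intros []; simpl; auto.
  - intros [] [];
      solve [ exists (tt :: nil)%list; intros []; simpl; auto
            | exists nil; intros [] ].
Qed.

Section Pullback.
Variables (C : category) (lim : finitely_complete C).
Variables (a b c : C) (f : hom a c) (g : hom b c).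

Definition cospan_fobj (i : cospan_ob) : C :=
  match i with cs_left => a | cs_right => b | cs_tip => c end.

Definition cospan_fmap (i j : cospan_ob) :
  cospan_hom i j -> hom (cospan_fobj i) (cospan_fobj j).
Proof.
  destruct i, j; simpl; intros [].
  - exact (idm a).
  - exact f.
  - exact (idm b).
  - exact g.
  - exact (idm c).
Defined.

Definition cospan_functor : functor cospan C.
Proof.
  refine (@Functor cospan C cospan_fobj cospan_fmap _ _).
  - intros []; reflexivity.
  - intros [] [] [] [] []; simpl; rewrite ?comp_idl, ?comp_idr; reflexivity.
Defined.

Definition pb_lim : limit cospan_functor := lim cospan_finite cospan_functor.

Definition pb : C := lim_ob pb_lim.
Definition pb_fst : hom pb a := lim_proj pb_lim cs_left.
Definition pb_snd : hom pb b := lim_proj pb_lim cs_right.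

Lemma pb_square : f ∘ pb_fst = g ∘ pb_snd.
Proof.
  transitivity (lim_proj pb_lim cs_tip).
  - exact (lim_cone pb_lim (i := cs_left) (j := cs_tip) tt).
  - symmetry; exact (lim_cone pb_lim (i := cs_right) (j := cs_tip) tt).
Qed.

Section Med.
Variables (z : C) (x : hom z a) (y : hom z b) (e : f ∘ x = g ∘ y).

Definition cospan_cone (i : cospan_ob) : hom z (cospan_fobj i) :=
  match i with cs_left => x | cs_right => y | cs_tip => f ∘ x end.

Lemma cospan_is_cone : @is_cone cospan C cospan_functor z cospan_cone.
Proof. intros [] [] []; simpl; rewrite ?comp_idl; auto. Qed.

Definition pb_med : hom z pb := lim_med pb_lim cospan_is_cone.

Lemma pb_med_fst : pb_fst ∘ pb_med = x.
Proof. exact (lim_medP pb_lim cospan_is_cone cs_left). Qed.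

Lemma pb_med_snd : pb_snd ∘ pb_med = y.
Proof. exact (lim_medP pb_lim cospan_is_cone cs_right). Qed.
End Med.

Lemma pb_uniq (z : C) (s t : hom z pb) :
  pb_fst ∘ s = pb_fst ∘ t -> pb_snd ∘ s = pb_snd ∘ t -> s = t.
Proof.
  intros e1 e2; apply (lim_uniq (l := pb_lim)); intros [].
  - exact e1.
  - exact e2.
  - assert (k := lim_cone pb_lim (i := cs_left) (j := cs_tip) tt).
    rewrite <- k, <- !comp_assoc; f_equal; exact e1.
Qed.

Lemma pb_is_pullback : is_pullback pb_fst pb_snd f g.
Proof.
  split; [exact pb_square|]; intros z x y e.
  exists (pb_med e); split; [split; [apply pb_med_fst|apply pb_med_snd]|].
  intros t [e1 e2]; apply pb_uniq; rewrite ?pb_med_fst, ?pb_med_snd; auto.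
Qed.
End Pullback.

(** * Extremal decompositions *)

Definition morphism_class (D : category) := forall a b : D, hom a b -> Prop.

Definition is_extremal (D : category) (Theta : morphism_class D) (U X T : D)
    (v : hom U T) (w : hom X T) (u : hom U X) : Prop :=
  v = w ∘ u /\ Theta U X u /\
  forall (X' : D) (w' : hom X' T) (u' : hom U X'),
    v = w' ∘ u' -> Theta U X' u' ->
    exists! t : hom X' X, w ∘ t = w' /\ t ∘ u' = u.

Definition has_extremal_decompositions (D : category)
    (Theta : morphism_class D) : Prop :=
  forall (U T : D) (v : hom U T), is_mono v ->
    exists (X : D) (w : hom X T) (u : hom U X), is_extremal Theta v w u.

(** [v'] and [w'] are pullbacks of [v] and [w] along [th]; [u'] is then the
    map induced between the two pullbacks. *)
Definition extremal_decompositions_stable (D : category)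
    (Theta : morphism_class D) : Prop :=
  forall (U X T : D) (v : hom U T) (w : hom X T) (u : hom U X),
    is_mono v -> is_extremal Theta v w u ->
  forall (T' : D) (th : hom T' T), Theta T' T th ->
  forall (U' X' : D) (v' : hom U' T') (thU : hom U' U)
         (w' : hom X' T') (thX : hom X' X) (u' : hom U' X'),
    is_pullback thU v' v th -> is_pullback thX w' w th ->
    w' ∘ u' = v' -> thX ∘ u' = u ∘ thU ->
    is_extremal Theta v' w' u'.

Definition stably_extremal_decompositions (D : category)
    (Theta : morphism_class D) : Prop :=
  has_extremal_decompositions Theta /\ extremal_decompositions_stable Theta.

(** * Points *)

Record point (E : category) (Y : E) := Point {
  pt_dom : E;
  pt_map : hom pt_dom Y;
  pt_sec : hom Y pt_dom;
  pt_split : pt_map ∘ pt_sec = idm Y }.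

Section Points.
Variable E : category.

Record pt_ob := PtOb { pt_base : E; pt_point :> point pt_base }.

Record pt_hom (p q : pt_ob) := PtHom {
  pth_base : hom (pt_base p) (pt_base q);
  pth_dom : hom (pt_dom p) (pt_dom q);
  pth_map : pt_map q ∘ pth_dom = pth_base ∘ pt_map p;
  pth_sec : pth_dom ∘ pt_sec p = pt_sec q ∘ pth_base }.

Lemma pt_hom_eq (p q : pt_ob) (f g : pt_hom p q) :
  pth_base f = pth_base g -> pth_dom f = pth_dom g -> f = g.
Proof.
  destruct f, g; simpl; intros; subst; f_equal; apply proof_irrelevance.
Qed.

Definition pt_id (p : pt_ob) : pt_hom p p.
Proof.
  exists (idm _) (idm _); rewrite comp_idl, comp_idr; reflexivity.
Defined.

Definition pt_comp (p q r : pt_ob) (g : pt_hom q r) (f : pt_hom p q) : pt_hom p r.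
Proof.
  exists (pth_base g ∘ pth_base f) (pth_dom g ∘ pth_dom f).
  - rewrite comp_assoc, pth_map, <- !comp_assoc, pth_map; reflexivity.
  - rewrite comp_assoc, <- pth_sec, <- !comp_assoc, pth_sec; reflexivity.
Defined.

Definition Pt : category.
Proof.
  refine (@Category pt_ob pt_hom pt_id pt_comp _ _ _); intros;
    apply pt_hom_eq; simpl;
    first [apply comp_idl | apply comp_idr | apply comp_assoc].
Defined.

Definition pt_cartesian : morphism_class Pt := fun p q (f : pt_hom p q) =>
  is_pullback (pth_dom f) (pt_map p) (pt_map q) (pth_base f).

Definition stably_decomposable : Prop :=
  stably_extremal_decompositions pt_cartesian.

Variable Y : E.

Record fib_hom (p q : point Y) := FibHom {
  fib_dom : hom (pt_dom p) (pt_dom q);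
  fib_map : pt_map q ∘ fib_dom = pt_map p;
  fib_sec : fib_dom ∘ pt_sec p = pt_sec q }.

Lemma fib_hom_eq (p q : point Y) (f g : fib_hom p q) :
  fib_dom f = fib_dom g -> f = g.
Proof.
  destruct f, g; simpl; intros; subst; f_equal; apply proof_irrelevance.
Qed.

Definition fib_id (p : point Y) : fib_hom p p.
Proof. exists (idm _); [apply comp_idr | apply comp_idl]. Defined.

Definition fib_comp (p q r : point Y) (g : fib_hom q r) (f : fib_hom p q) :
  fib_hom p r.
Proof.
  exists (fib_dom g ∘ fib_dom f).
  - rewrite comp_assoc, !fib_map; reflexivity.
  - rewrite <- comp_assoc, !fib_sec; reflexivity.
Defined.

(** The fibre of [Pt] over [Y]: the maps are those lying over [idm Y]. *)
Definition PtFib : category.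
Proof.
  refine (@Category (point Y) fib_hom fib_id fib_comp _ _ _); intros;
    apply fib_hom_eq; simpl;
    first [apply comp_idl | apply comp_idr | apply comp_assoc].
Defined.
End Points.

(** * Base change *)

Section BaseChange.
Variables (E : category) (lim : finitely_complete E).
Variables (Y' Y : E) (h : hom Y' Y).

Lemma bc_sec_square (p : point Y) : pt_map p ∘ (pt_sec p ∘ h) = h ∘ idm Y'.
Proof. rewrite comp_assoc, pt_split, comp_idl, comp_idr; reflexivity. Qed.

Definition bc_ob (p : point Y) : point Y' :=
  @Point E Y' (pb lim (pt_map p) h) (pb_snd lim (pt_map p) h)
    (pb_med lim (bc_sec_square p)) (pb_med_snd lim (bc_sec_square p)).

Lemma bc_dom_square (p q : point Y) (x : fib_hom p q) :
  pt_map q ∘ (fib_dom x ∘ pb_fst lim (pt_map p) h) =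
  h ∘ pb_snd lim (pt_map p) h.
Proof. rewrite comp_assoc, fib_map; apply pb_square. Qed.

Definition bc_hom (p q : point Y) (x : fib_hom p q) :
  fib_hom (bc_ob p) (bc_ob q).
Proof.
  exists (pb_med lim (bc_dom_square x)).
  - apply pb_med_snd.
  - apply pb_uniq; simpl; rewrite comp_assoc.
    + rewrite !pb_med_fst, <- comp_assoc, pb_med_fst, comp_assoc, fib_sec.
      reflexivity.
    + rewrite !pb_med_snd; reflexivity.
Defined.

Definition base_change : functor (PtFib Y) (PtFib Y').
Proof.
  refine (@Functor (PtFib Y) (PtFib Y') bc_ob bc_hom _ _).
  - intros p; apply fib_hom_eq; apply pb_uniq; simpl;
      rewrite ?pb_med_fst, ?pb_med_snd, ?comp_idl, ?comp_idr; reflexivity.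
  - intros p q r g f; apply fib_hom_eq; apply pb_uniq; simpl;
      rewrite !comp_assoc, ?pb_med_fst, ?pb_med_snd; [|reflexivity].
    rewrite <- !comp_assoc, pb_med_fst; reflexivity.
Defined.
End BaseChange.

(** * Normal monomorphisms *)

Section Normal.
Variable C : category.

(** A span [(d0, d1)] on [X] is an internal equivalence relation when
    [hom Z R -> hom Z X * hom Z X] is an equivalence relation in sets, for
    every [Z]. *)
Definition is_equivalence_relation (R X : C) (d0 d1 : hom R X) : Prop :=
  (forall (Z : C) (a b : hom Z R), d0 ∘ a = d0 ∘ b -> d1 ∘ a = d1 ∘ b -> a = b) /\
  (forall Z : C, equivalence (hom Z X)
     (fun x y => exists r : hom Z R, d0 ∘ r = x /\ d1 ∘ r = y)).

(** [(e0, e1)] on [U] is the inverse image along [u] of [(d0, d1)] on [X]: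
    [S] is the pullback of [(d0, d1) : R -> X * X] along [u * u]. *)
Definition is_inverse_image (U X S R : C) (u : hom U X)
    (e0 e1 : hom S U) (d0 d1 : hom R X) (k : hom S R) : Prop :=
  d0 ∘ k = u ∘ e0 /\ d1 ∘ k = u ∘ e1 /\
  forall (Z : C) (x y : hom Z U) (r : hom Z R),
    d0 ∘ r = u ∘ x -> d1 ∘ r = u ∘ y ->
    exists! t : hom Z S, e0 ∘ t = x /\ e1 ∘ t = y /\ k ∘ t = r.

Definition is_normal_to (U X R : C) (u : hom U X) (d0 d1 : hom R X) : Prop :=
  exists (UU : C) (p0 p1 : hom UU U) (k : hom UU R),
    is_product p0 p1 /\ is_inverse_image u p0 p1 d0 d1 k /\
    is_pullback p0 k u d0.

Definition is_normal_mono (U X : C) (u : hom U X) : Prop :=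
  is_mono u /\
  exists (R : C) (d0 d1 : hom R X),
    is_equivalence_relation d0 d1 /\ is_normal_to u d0 d1.
End Normal.

Definition reflects_normal_monos (C D : category) (F : functor C D) : Prop :=
  forall (U X : C) (u : hom U X), is_normal_mono (fmap F u) -> is_normal_mono u.

(** * Protomodularity *)

Definition protomodular (E : category) (lim : finitely_complete E) : Prop :=
  forall (Y' Y : E) (h : hom Y' Y), conservative (base_change lim h).

Definition strongly_protomodular (E : category) (lim : finitely_complete E) : Prop :=
  protomodular lim /\
  forall (Y' Y : E) (h : hom Y' Y), reflects_normal_monos (base_change lim h).

(* Main.v *)
From Stdlib Require Import Relation_Definitions.
Require Import Defs.

Set Implicit Arguments.
Unset Strict Implicit.
Unset Printing Implicit Defensive.
Local Open Scope cat_scope.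

(** Write [nabla p] for the point [X ×_Y X ⇄ X] (first projection, diagonal)
    attached to a point [p] with domain [X] over [Y].  Let [u : U → X] be a map
    of points over [Y] whose base change [u'] along [h : Y' → Y] is a normal
    monomorphism.  Protomodularity makes [u] a monomorphism, hence so is the
    map [v : nabla U → nabla X] that it induces between points.  Take an
    extremal decomposition of [v] through an object [(N, W)], a point [W ⇄ N],
    with [U → N] and [N → X] on bases: it plays the role of a normalizer of
    [u].

    The map [nabla X' → nabla X] given by base change is cartesian, and it
    pulls [v] back to the map [v'] induced by [u'].  By stability the pulled
    back decomposition of [v'] is extremal.  But if [u'] is normal to [R'],
    then [v'] also decomposes through the point [R' ⇄ X'], whose base is the
    whole of [X'] ([normal_decomposition]).  Extremality compares the two, so
    [X' → X] factors through [N → X].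

    The map [N → X] is a monomorphism ([extremal_mono]) through which both
    [X' → X] and the section [Y → X] factor; in a protomodular category these
    two maps are jointly strongly epic ([point_cover]), so [N → X] is
    invertible.  Then [W] is a reflexive relation on [X], and the cartesian
    map [nabla U → W] is a discrete fibration over [u]; one more use of
    protomodularity makes [W] an equivalence relation
    ([equivalence_along_discrete_fibration]), to which [u] is normal
    ([decomposition_normal]). *)

(** * Rewriting up to associativity *)

Lemma comp_whisker (C : category) (a b c : C) (g : hom b c) (f : hom a b)
    (k : hom a c) :
  g ∘ f = k -> forall (z : C) (x : hom z a), g ∘ (f ∘ x) = k ∘ x.
Proof. intros <- z x; apply comp_assoc. Qed.

(** Right-associated composites hide [g ∘ f] inside [g ∘ (f ∘ x)], where
    [e : g ∘ f = k] is only visible through [comp_whisker]. *)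
Ltac crw e :=
  rewrite <- ?comp_assoc;
  first [rewrite (comp_whisker e) | rewrite e];
  rewrite <- ?comp_assoc.

Ltac cnorm := rewrite <- ?comp_assoc, ?comp_idl, ?comp_idr.

(** * Pullbacks *)

Section PullbackFacts.
Variables (C : category) (p0 a b c : C).
Variables (p : hom p0 a) (q : hom p0 b) (f : hom a c) (g : hom b c).

Lemma pullback_lift (H : is_pullback p q f g) (z : C) (x : hom z a) (y : hom z b) :
  f ∘ x = g ∘ y -> exists t : hom z p0, p ∘ t = x /\ q ∘ t = y.
Proof. intros e; destruct (proj2 H z x y e) as [t [ht _]]; eauto. Qed.

Lemma pullback_joint (H : is_pullback p q f g) (z : C) (s t : hom z p0) :
  p ∘ s = p ∘ t -> q ∘ s = q ∘ t -> s = t.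
Proof.
  intros e1 e2.
  destruct (proj2 H z (p ∘ t) (q ∘ t)) as [r [_ hr]].
  - rewrite !comp_assoc, (proj1 H); reflexivity.
  - transitivity r; [symmetry|]; apply hr; auto.
Qed.

Lemma pullback_intro :
  f ∘ p = g ∘ q ->
  (forall (z : C) (s t : hom z p0), p ∘ s = p ∘ t -> q ∘ s = q ∘ t -> s = t) ->
  (forall (z : C) (x : hom z a) (y : hom z b), f ∘ x = g ∘ y ->
    exists t : hom z p0, p ∘ t = x /\ q ∘ t = y) ->
  is_pullback p q f g.
Proof.
  intros e hj hl; split; [exact e|]; intros z x y exy.
  destruct (hl z x y exy) as [t [e1 e2]].
  exists t; split; [auto|]; intros s [e3 e4]; apply hj; congruence.
Qed.

End PullbackFacts.

Lemma pullback_iso (C : category) (p0 a b c : C) (p : hom p0 a) (q : hom p0 b)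
    (f : hom a c) (g : hom b c) (H : is_pullback p q f g) (p1 : C) (j : hom p1 p0)
    (i : hom p0 p1) :
  i ∘ j = idm p1 -> j ∘ i = idm p0 -> is_pullback (p ∘ j) (q ∘ j) f g.
Proof.
  intros eij eji; apply pullback_intro.
  - rewrite !comp_assoc, (proj1 H); reflexivity.
  - intros z s t e1 e2.
    assert (e : j ∘ s = j ∘ t)
      by (apply (pullback_joint H); rewrite !comp_assoc; auto).
    rewrite <- (comp_idl s), <- (comp_idl t), <- eij, <- !comp_assoc, e.
    reflexivity.
  - intros z x y e; destruct (pullback_lift H e) as [t [e1 e2]].
    exists (i ∘ t); crw eji; rewrite comp_idl; auto.
Qed.

Section ChosenPullback.
Variables (C : category) (lim : finitely_complete C).
Variables (a b c : C) (f : hom a c) (g : hom b c).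

Lemma pb_lift (z : C) (x : hom z a) (y : hom z b) : f ∘ x = g ∘ y ->
  exists t : hom z (pb lim f g), pb_fst lim f g ∘ t = x /\ pb_snd lim f g ∘ t = y.
Proof. apply pullback_lift, pb_is_pullback. Qed.
End ChosenPullback.

Lemma kernel_pair_mono (C : category) (a b p0 : C) (f : hom a b)
    (p q : hom p0 a) : is_pullback p q f f -> p = q -> is_mono f.
Proof.
  intros H e z g h egh; destruct (pullback_lift H egh) as [t [<- <-]].
  rewrite e; reflexivity.
Qed.

Lemma pullback_sym (C : category) (p0 a b c : C) (p : hom p0 a) (q : hom p0 b)
    (f : hom a c) (g : hom b c) : is_pullback p q f g -> is_pullback q p g f.
Proof.
  intros H; apply pullback_intro; [symmetry; exact (proj1 H)| |].
  - intros z s t e1 e2; exact (pullback_joint H e2 e1).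
  - intros z x y e; destruct (pullback_lift H (eq_sym e)) as [t [t1 t2]]; eauto.
Qed.

Lemma kernel_pair_equivalence (C : category) (a b p0 : C) (f : hom a b)
    (p q : hom p0 a) : is_pullback p q f f -> is_equivalence_relation p q.
Proof.
  intros H; split; [exact (@pullback_joint _ _ _ _ _ _ _ _ _ H)|].
  assert (sq : forall (z : C) (r : hom z p0), f ∘ (p ∘ r) = f ∘ (q ∘ r))
    by (intros z r; rewrite !comp_assoc, (proj1 H); reflexivity).
  intros z; constructor.
  - intros x; exact (pullback_lift H eq_refl).
  - intros x y w [r [<- <-]] [r' [e <-]]; apply (pullback_lift H).
    rewrite sq, <- e; apply sq.
  - intros x y [r [<- <-]]; apply (pullback_lift H); symmetry; apply sq.
Qed.

(** * Pullbacks and monomorphisms of points *)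

Section PtPullback.
Variables (E : category) (lim : finitely_complete E).

(** The compatibility of the induced map with projections and sections comes
    from the uniqueness parts of the two pullbacks. *)
Lemma pt_pullback_intro (P A B T : Pt E) (p : hom P A) (q : hom P B)
    (f : hom A T) (g : hom B T) :
  is_pullback (pth_base p) (pth_base q) (pth_base f) (pth_base g) ->
  is_pullback (pth_dom p) (pth_dom q) (pth_dom f) (pth_dom g) ->
  is_pullback p q f g.
Proof.
  intros Hb Hd; apply pullback_intro.
  - apply pt_hom_eq; [exact (proj1 Hb)|exact (proj1 Hd)].
  - intros z s t e1 e2; apply pt_hom_eq.
    + apply (pullback_joint Hb);
        [exact (f_equal (@pth_base _ _ _) e1)|exact (f_equal (@pth_base _ _ _) e2)].
    + apply (pullback_joint Hd);
        [exact (f_equal (@pth_dom _ _ _) e1)|exact (f_equal (@pth_dom _ _ _) e2)].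
  - intros z x y e.
    destruct (pullback_lift Hb (f_equal (@pth_base _ _ _) e)) as [tb [b1 b2]].
    destruct (pullback_lift Hd (f_equal (@pth_dom _ _ _) e)) as [td [d1 d2]].
    assert (hm : pt_map P ∘ td = tb ∘ pt_map z).
    { apply (pullback_joint Hb).
      - crw (eq_sym (pth_map p)); crw b1; crw d1; exact (pth_map x).
      - crw (eq_sym (pth_map q)); crw b2; crw d2; exact (pth_map y). }
    assert (hs : td ∘ pt_sec z = pt_sec P ∘ tb).
    { apply (pullback_joint Hd).
      - crw d1; crw (pth_sec p); crw b1; exact (pth_sec x).
      - crw d2; crw (pth_sec q); crw b2; exact (pth_sec y). }
    exists (PtHom hm hs); split; apply pt_hom_eq; assumption.
Qed.

Section Def.
Variables (A B T : pt_ob E) (f : pt_hom A T) (g : pt_hom B T).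

Lemma pt_pb_map_square :
  pth_base f ∘ (pt_map A ∘ pb_fst lim (pth_dom f) (pth_dom g)) =
  pth_base g ∘ (pt_map B ∘ pb_snd lim (pth_dom f) (pth_dom g)).
Proof.
  crw (eq_sym (pth_map f)); crw (eq_sym (pth_map g)); crw (pb_square lim).
  reflexivity.
Qed.

Lemma pt_pb_sec_square :
  pth_dom f ∘ (pt_sec A ∘ pb_fst lim (pth_base f) (pth_base g)) =
  pth_dom g ∘ (pt_sec B ∘ pb_snd lim (pth_base f) (pth_base g)).
Proof. crw (pth_sec f); crw (pth_sec g); crw (pb_square lim); reflexivity. Qed.

Lemma pt_pb_split :
  pb_med lim pt_pb_map_square ∘ pb_med lim pt_pb_sec_square = idm _.
Proof.
  apply pb_uniq; cnorm.
  - crw (pb_med_fst lim pt_pb_map_square); crw (pb_med_fst lim pt_pb_sec_square).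
    crw (pt_split A); apply comp_idl.
  - crw (pb_med_snd lim pt_pb_map_square); crw (pb_med_snd lim pt_pb_sec_square).
    crw (pt_split B); apply comp_idl.
Qed.

Definition pt_pb : Pt E := PtOb (Point pt_pb_split).

Definition pt_pb_fst : @hom (Pt E) pt_pb A.
Proof.
  exists (pb_fst _ _ _) (pb_fst _ _ _); simpl;
    [symmetry; apply (pb_med_fst lim pt_pb_map_square)
    |apply (pb_med_fst lim pt_pb_sec_square)].
Defined.

Definition pt_pb_snd : @hom (Pt E) pt_pb B.
Proof.
  exists (pb_snd _ _ _) (pb_snd _ _ _); simpl;
    [symmetry; apply (pb_med_snd lim pt_pb_map_square)
    |apply (pb_med_snd lim pt_pb_sec_square)].
Defined.

Lemma pt_pb_is_pullback : @is_pullback (Pt E) _ _ _ _ pt_pb_fst pt_pb_snd f g.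
Proof. apply pt_pullback_intro; apply pb_is_pullback. Qed.
End Def.

(** The kernel pair of [f] is computed on bases and domains separately, and its
    two projections agree when [f] is monic. *)
Lemma pt_mono_components (A B : Pt E) (f : hom A B) :
  is_mono f -> is_mono (pth_base f) /\ is_mono (pth_dom f).
Proof.
  intros H.
  assert (e : pt_pb_fst f f = pt_pb_snd f f)
    by (apply H; exact (proj1 (pt_pb_is_pullback f f))).
  split; eapply kernel_pair_mono; try apply (pb_is_pullback lim).
  - exact (f_equal (@pth_base _ _ _) e).
  - exact (f_equal (@pth_dom _ _ _) e).
Qed.

Lemma pt_mono_intro (A B : Pt E) (f : hom A B) :
  is_mono (pth_base f) -> is_mono (pth_dom f) -> is_mono f.
Proof.
  intros Hb Hd z g h e; apply pt_hom_eq;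
    [apply Hb; exact (f_equal (@pth_base _ _ _) e)
    |apply Hd; exact (f_equal (@pth_dom _ _ _) e)].
Qed.
End PtPullback.

(** * Pullbacks in a fibre *)

Section Fibre.
Variables (E : category) (lim : finitely_complete E) (Y : E).

Section Def.
Variables (p q r : point Y) (f : fib_hom p r) (g : fib_hom q r).

Lemma fib_pb_sec_square : fib_dom f ∘ pt_sec p = fib_dom g ∘ pt_sec q.
Proof. rewrite !fib_sec; reflexivity. Qed.

Lemma fib_pb_split :
  (pt_map p ∘ pb_fst lim (fib_dom f) (fib_dom g)) ∘ pb_med lim fib_pb_sec_square
  = idm Y.
Proof. crw (pb_med_fst lim fib_pb_sec_square); apply pt_split. Qed.

Definition fib_pb : PtFib Y := Point fib_pb_split.

Definition fib_pb_fst : @hom (PtFib Y) fib_pb p.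
Proof. exists (pb_fst _ _ _); [reflexivity|apply pb_med_fst]. Defined.

Definition fib_pb_snd : @hom (PtFib Y) fib_pb q.
Proof.
  exists (pb_snd _ _ _); [|apply pb_med_snd].
  simpl; rewrite <- (fib_map g), <- (fib_map f); crw (pb_square lim); reflexivity.
Defined.

Lemma fib_pb_lift (z : point Y) (x : fib_hom z p) (y : fib_hom z q) :
  fib_dom f ∘ fib_dom x = fib_dom g ∘ fib_dom y ->
  exists t : @hom (PtFib Y) z fib_pb, fib_pb_fst ∘ t = x /\ fib_pb_snd ∘ t = y.
Proof.
  intros e; destruct (pb_lift lim e) as [t [e1 e2]].
  assert (hm : pt_map fib_pb ∘ t = pt_map z)
    by (simpl; crw e1; apply fib_map).
  assert (hs : t ∘ pt_sec z = pt_sec fib_pb).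
  { apply pb_uniq; simpl.
    - rewrite pb_med_fst; crw e1; apply fib_sec.
    - rewrite pb_med_snd; crw e2; apply fib_sec. }
  exists (FibHom hm hs); split; apply fib_hom_eq; assumption.
Qed.
End Def.

(** The pullback computed in the category is itself a point, so it compares
    with the one given in the fibre, and the comparison is invertible. *)
Lemma fib_pullback_dom (P p q r : PtFib Y) (a : hom P p) (b : hom P q)
    (f : hom p r) (g : hom q r) :
  is_pullback a b f g ->
  is_pullback (fib_dom a) (fib_dom b) (fib_dom f) (fib_dom g).
Proof.
  intros H.
  assert (sq := f_equal (@fib_dom _ _ _ _) (proj1 H) :
            fib_dom f ∘ fib_dom a = fib_dom g ∘ fib_dom b).
  destruct (fib_pb_lift sq) as [i [i1 i2]].
  assert (sq' : f ∘ fib_pb_fst f g = g ∘ fib_pb_snd f g)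
    by (apply fib_hom_eq; apply pb_square).
  destruct (pullback_lift H sq') as [j [j1 j2]].
  assert (eji : j ∘ i = idm P).
  { apply (pullback_joint H); cnorm.
    - crw j1; exact i1.
    - crw j2; exact i2. }
  assert (eij : fib_dom i ∘ fib_dom j = idm _).
  { apply pb_uniq; cnorm.
    - transitivity (fib_dom a ∘ fib_dom j).
      + rewrite <- i1; apply comp_assoc.
      + exact (f_equal (@fib_dom _ _ _ _) j1).
    - transitivity (fib_dom b ∘ fib_dom j).
      + rewrite <- i2; apply comp_assoc.
      + exact (f_equal (@fib_dom _ _ _ _) j2). }
  rewrite <- i1, <- i2.
  apply (pullback_iso (pb_is_pullback lim (fib_dom f) (fib_dom g))
           (i := fib_dom j)).
  - exact (f_equal (@fib_dom _ _ _ _) eji).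
  - exact eij.
Qed.

Lemma fib_pullback_intro (P p q r : PtFib Y) (a : hom P p) (b : hom P q)
    (f : hom p r) (g : hom q r) :
  is_pullback (fib_dom a) (fib_dom b) (fib_dom f) (fib_dom g) ->
  is_pullback a b f g.
Proof.
  intros H; apply pullback_intro.
  - apply fib_hom_eq; exact (proj1 H).
  - intros z s t e1 e2; apply fib_hom_eq, (pullback_joint H);
      [exact (f_equal (@fib_dom _ _ _ _) e1)|exact (f_equal (@fib_dom _ _ _ _) e2)].
  - intros z x y e.
    destruct (pullback_lift H (f_equal (@fib_dom _ _ _ _) e)) as [t [t1 t2]].
    assert (hm : pt_map P ∘ t = pt_map z).
    { rewrite <- (fib_map a), <- comp_assoc, t1; apply fib_map. }
    assert (hs : t ∘ pt_sec z = pt_sec P).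
    { apply (pullback_joint H); rewrite comp_assoc, fib_sec.
      - rewrite t1; apply fib_sec.
      - rewrite t2; apply fib_sec. }
    exists (FibHom hm hs); split; apply fib_hom_eq; assumption.
Qed.

(** Monicity in the fibre only tests maps of points, but the kernel pair taken
    in the whole category is itself a point. *)
Lemma fib_mono_dom (p q : PtFib Y) (f : hom p q) :
  is_mono f -> is_mono (fib_dom f).
Proof.
  intros H.
  assert (e : fib_pb_fst f f = fib_pb_snd f f)
    by (apply H; apply fib_hom_eq; apply pb_square).
  eapply kernel_pair_mono; [apply (pb_is_pullback lim)|].
  exact (f_equal (@fib_dom _ _ _ _) e).
Qed.

Lemma fib_mono_intro (p q : PtFib Y) (f : hom p q) :
  is_mono (fib_dom f) -> is_mono f.
Proof.
  intros H z g h e; apply fib_hom_eq, H; exact (f_equal (@fib_dom _ _ _ _) e).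
Qed.

Definition fib_unit : PtFib Y := Point (comp_idl (idm Y)).

Definition fib_to_unit (p : point Y) : @hom (PtFib Y) p fib_unit.
Proof. exists (pt_map p); [apply comp_idl|apply pt_split]. Defined.

(** A product in the fibre is a pullback over its terminal object. *)
Lemma fib_product_dom (P p q : PtFib Y) (a : hom P p) (b : hom P q) :
  is_product a b ->
  is_pullback (fib_dom a) (fib_dom b) (pt_map p) (pt_map q).
Proof.
  intros H.
  assert (Hp : is_pullback a b (fib_to_unit p) (fib_to_unit q)).
  { split.
    - apply fib_hom_eq; simpl; rewrite !fib_map; reflexivity.
    - intros z x y _; apply H. }
  exact (fib_pullback_dom Hp).
Qed.
End Fibre.

(** * Joint strong epimorphicity in a protomodular category *)

Section Protomodular.
Variables (E : category) (lim : finitely_complete E) (pm : protomodular lim).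

(** The conclusion of protomodularity used throughout: the section of [p] and
    the projection [h^* p → p] are jointly strongly epic.  The second one is
    handled through its generalized elements, the pairs [(a, b)] with
    [pt_map p ∘ a = h ∘ b].  A subobject [S] containing both is again a point
    over [Y], and its inclusion becomes invertible after base change along
    [h]. *)
Lemma point_cover (Y Y' : E) (h : hom Y' Y) (p : point Y) (S : E)
    (m : hom S (pt_dom p)) (s : hom Y S) :
  is_mono m -> m ∘ s = pt_sec p ->
  (forall (z : E) (a : hom z (pt_dom p)) (b : hom z Y'), pt_map p ∘ a = h ∘ b ->
     exists c : hom z S, m ∘ c = a) ->
  is_iso m.
Proof.
  intros Hm es Hl.
  assert (split : pt_map p ∘ m ∘ s = idm Y) by (crw es; apply pt_split).
  set (q := Point split).
  set (mf := @FibHom E Y q p m eq_refl es).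
  destruct (Hl _ _ _ (pb_square lim (pt_map p) h)) as [t et].
  assert (sq : pt_map q ∘ t = h ∘ pb_snd lim (pt_map p) h)
    by (simpl; crw et; apply pb_square).
  assert (iso : is_iso (fmap (base_change lim h) (mf : @hom (PtFib Y) q p))).
  { assert (im : pt_map (bc_ob lim h q) ∘ pb_med lim sq = pt_map (bc_ob lim h p))
      by apply (pb_med_snd lim sq).
    assert (is : pb_med lim sq ∘ pt_sec (bc_ob lim h p) = pt_sec (bc_ob lim h q)).
    { apply pb_uniq; simpl.
      - rewrite pb_med_fst; crw (pb_med_fst lim sq); apply Hm.
        crw et; rewrite pb_med_fst; crw es; reflexivity.
      - rewrite pb_med_snd; crw (pb_med_snd lim sq); apply pb_med_snd. }
    exists (@FibHom E Y' (bc_ob lim h p) (bc_ob lim h q) _ im is); split;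
      apply fib_hom_eq; apply pb_uniq; simpl; cnorm.
    - crw (pb_med_fst lim sq); apply Hm; crw et; apply pb_med_fst.
    - crw (pb_med_snd lim sq); apply pb_med_snd.
    - rewrite comp_assoc, pb_med_fst, <- comp_assoc; simpl.
      transitivity (m ∘ t); [f_equal; exact (pb_med_fst lim sq)|exact et].
    - rewrite comp_assoc, pb_med_snd; apply pb_med_snd. }
  destruct (pm iso) as [i [e1 e2]].
  exists (fib_dom i); split;
    [exact (f_equal (@fib_dom _ _ _ _) e1)|exact (f_equal (@fib_dom _ _ _ _) e2)].
Qed.

(** Pulling [m] back along [f] reduces this to [point_cover]. *)
Lemma point_lift (Y Y' : E) (h : hom Y' Y) (p : point Y) (W Q : E)
    (m : hom W Q) (f : hom (pt_dom p) Q) (s : hom Y W) :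
  is_mono m -> m ∘ s = f ∘ pt_sec p ->
  (forall (z : E) (a : hom z (pt_dom p)) (b : hom z Y'), pt_map p ∘ a = h ∘ b ->
     exists c : hom z W, m ∘ c = f ∘ a) ->
  exists g : hom (pt_dom p) W, m ∘ g = f.
Proof.
  intros Hm es Hl.
  assert (Hf : is_mono (pb_fst lim f m)).
  { intros z a b e; apply pb_uniq; [exact e|]; apply Hm.
    rewrite !comp_assoc, <- !pb_square, <- !comp_assoc, e; reflexivity. }
  destruct (pb_lift lim (eq_sym es)) as [s' [es' _]].
  destruct (point_cover (h := h) Hf es') as [i [_ ei]].
  - intros z a b e; destruct (Hl z a b e) as [c ec].
    destruct (pb_lift lim (eq_sym ec)) as [d [ed _]]; eauto.
  - exists (pb_snd lim f m ∘ i).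
    rewrite comp_assoc, <- pb_square; crw ei; apply comp_idr.
Qed.

(** A map injective on the part of [p] over [Y'] is monic: lift the identity of
    its kernel pair, seen as a point over [Y], through the diagonal.  The map
    [k] is what makes the kernel pair a point over [Y]. *)
Lemma point_mono (Y Y' : E) (h : hom Y' Y) (p : point Y) (M : E)
    (m : hom (pt_dom p) M) (k : hom M Y) :
  k ∘ m = pt_map p ->
  (forall (z : E) (a b : hom z (pt_dom p)) (c : hom z Y'),
     pt_map p ∘ a = h ∘ c -> pt_map p ∘ b = h ∘ c -> m ∘ a = m ∘ b -> a = b) ->
  is_mono m.
Proof.
  intros ek Hf.
  set (K := pb lim m m); set (k0 := pb_fst lim m m); set (k1 := pb_snd lim m m).
  destruct (pb_lift lim (eq_refl (m ∘ idm (pt_dom p)))) as [d [d0 d1]].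
  assert (split : (pt_map p ∘ k0) ∘ (d ∘ pt_sec p) = idm Y)
    by (crw d0; rewrite comp_idl; apply pt_split).
  assert (Hd : is_mono d).
  { intros z a b e.
    rewrite <- (comp_idl a), <- (comp_idl b), <- d0, <- !comp_assoc, e.
    reflexivity. }
  destruct (point_lift (h := h) (p := Point split) (m := d) (f := idm K)
              (s := pt_sec p)) as [g eg]; simpl; auto.
  - rewrite comp_idl; reflexivity.
  - intros z a b e; exists (k0 ∘ a); rewrite comp_idl.
    rewrite <- comp_assoc in e.
    assert (e01 : k0 ∘ a = k1 ∘ a).
    { apply Hf with b; [exact e| |].
      - rewrite <- e, <- ek; unfold k0, k1.
        rewrite <- !comp_assoc, (comp_assoc m (pb_snd _ _ _)), <- pb_square.
        rewrite !comp_assoc; reflexivity.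
      - unfold k0, k1; rewrite !comp_assoc, pb_square; reflexivity. }
    apply pb_uniq; fold K k0 k1.
    + crw d0; apply comp_idl.
    + crw d1; rewrite comp_idl; exact e01.
  - apply (kernel_pair_mono (pb_is_pullback lim m m)); fold k0 k1.
    enough (Hg : forall j : hom K (pt_dom p), j ∘ d = idm _ -> j = g)
      by (transitivity g; [|symmetry]; auto).
    intros j ej; transitivity (j ∘ idm K); [symmetry; apply comp_idr|].
    rewrite <- eg; crw ej; apply comp_idl.
Qed.

(** View [W] as a point over [X] through [d0] and the reflexivity map.  Over
    [U], the discrete fibration identifies it with the equivalence relation
    [S], so symmetry and transitivity hold when the first variable ranges over
    [U]; they hold trivially on the section.  By [point_lift] they hold
    everywhere.  The map [f] embeds [W] in [X ×_B X], the ambient object in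
    which these lifts are sought. *)
Lemma equivalence_along_discrete_fibration (X B W U S : E) (f : hom X B)
    (d0 d1 : hom W X) (e : hom X W) (u : hom U X) (p0 p1 : hom S U) (k : hom S W) :
  f ∘ d0 = f ∘ d1 ->
  (forall (z : E) (a b : hom z W), d0 ∘ a = d0 ∘ b -> d1 ∘ a = d1 ∘ b -> a = b) ->
  d0 ∘ e = idm X -> d1 ∘ e = idm X ->
  is_equivalence_relation p0 p1 ->
  is_pullback k p0 d0 u -> d1 ∘ k = u ∘ p1 ->
  is_equivalence_relation d0 d1.
Proof.
  intros ef Hj e0 e1 [_ HS] Hk ek1; split; [exact Hj|].
  destruct (pb_lift lim ef) as [m [m0 m1]].
  assert (Hm : is_mono m).
  { intros z a b eab; apply Hj.
    - rewrite <- m0, <- !comp_assoc, eab; reflexivity.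
    - rewrite <- m1, <- !comp_assoc, eab; reflexivity. }
  assert (ek0 := proj1 Hk).
  (* The generic pair of [W], swapped, lies in [W]. *)
  assert (Hs : exists g : hom W W, d0 ∘ g = d1 /\ d1 ∘ g = d0).
  { destruct (pb_lift lim (eq_sym ef)) as [n [n0 n1]].
    destruct (point_lift (h := u) (p := Point e0) (m := m) (f := n) (s := e))
      as [g eg]; simpl; auto.
    - apply pb_uniq; rewrite !comp_assoc.
      + rewrite m0, n0, e0, e1; reflexivity.
      + rewrite m1, n1, e0, e1; reflexivity.
    - intros z a b eab; destruct (pullback_lift Hk eab) as [t [t0 t1]].
      destruct (equiv_sym _ _ (HS z) _ _
                  (ex_intro _ t (conj eq_refl eq_refl))) as [r [r0 r1]].
      exists (k ∘ r); apply pb_uniq; rewrite !comp_assoc.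
      + rewrite m0, n0, ek0, <- t0; crw r0; rewrite !comp_assoc, ek1; reflexivity.
      + rewrite m1, n1, ek1, <- t0; crw r1; rewrite !comp_assoc, ek0; reflexivity.
    - simpl in g, eg; exists g; split.
      + rewrite <- m0, <- comp_assoc, eg; exact n0.
      + rewrite <- m1, <- comp_assoc, eg; exact n1. }
  (* The outer ends of the generic chain [a W b W c] are related; such chains
     form a point over [X] by projection to [a]. *)
  assert (Ht : exists g : hom (pb lim d1 d0) W,
            d0 ∘ g = d0 ∘ pb_fst lim d1 d0 /\ d1 ∘ g = d1 ∘ pb_snd lim d1 d0).
  { assert (en : f ∘ (d0 ∘ pb_fst lim d1 d0) = f ∘ (d1 ∘ pb_snd lim d1 d0)).
    { rewrite (comp_assoc f d0), ef, <- comp_assoc, pb_square.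
      rewrite !comp_assoc, ef; reflexivity. }
    destruct (pb_lift lim en) as [n [n0 n1]].
    destruct (pb_lift lim (eq_trans e1 (eq_sym e0))) as [ee [ee0 ee1]].
    assert (split : (d0 ∘ pb_fst lim d1 d0) ∘ ee = idm X) by (crw ee0; exact e0).
    destruct (point_lift (h := u) (p := Point split) (m := m) (f := n) (s := e))
      as [g eg]; simpl; auto.
    - apply pb_uniq; rewrite !comp_assoc.
      + rewrite m0, n0; crw ee0; reflexivity.
      + rewrite m1, n1; crw ee1; reflexivity.
    - intros z a b eab; rewrite <- comp_assoc in eab.
      destruct (pullback_lift Hk eab) as [t [t0 t1]].
      assert (eab' : d0 ∘ (pb_snd lim d1 d0 ∘ a) = u ∘ (p1 ∘ t)).
      { rewrite comp_assoc, <- pb_square, <- comp_assoc, <- t0.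
        rewrite !comp_assoc, ek1; reflexivity. }
      destruct (pullback_lift Hk eab') as [t' [t0' t1']].
      destruct (equiv_trans _ _ (HS z) _ _ _
                  (ex_intro _ t (conj eq_refl eq_refl))
                  (ex_intro _ t' (conj t1' eq_refl))) as [r [r0 r1]].
      exists (k ∘ r); apply pb_uniq; rewrite !comp_assoc.
      + rewrite m0, n0, ek0, <- !comp_assoc, r0, t1; auto.
      + rewrite m1, n1, ek1, <- !comp_assoc, r1, <- t0', !comp_assoc, ek1; auto.
    - simpl in g, eg; exists g; split.
      + transitivity (pb_fst lim f f ∘ (m ∘ g));
          [rewrite comp_assoc, m0; reflexivity|rewrite eg; exact n0].
      + transitivity (pb_snd lim f f ∘ (m ∘ g));
          [rewrite comp_assoc, m1; reflexivity|rewrite eg; exact n1]. }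
  destruct Hs as [s [s0 s1]], Ht as [c [c0 c1]].
  intros z; constructor.
  - intros x; exists (e ∘ x); rewrite !comp_assoc, e0, e1, comp_idl; auto.
  - intros x y w [r [<- <-]] [r' [er' <-]].
    destruct (pb_lift lim (eq_sym er')) as [t [t0 t1]].
    exists (c ∘ t); split.
    + crw c0; rewrite t0; reflexivity.
    + crw c1; rewrite t1; reflexivity.
  - intros x y [r [<- <-]]; exists (s ∘ r); rewrite !comp_assoc, s0, s1; auto.
Qed.

(** * Extremal decompositions of monomorphisms *)

(** The kernel pair [K] of [w] also decomposes [v], with two comparison maps
    [K → X], its projections; the uniqueness in extremality identifies them.
    The point to check is that the induced [d : U → K] is cartesian.  Elements
    [(a, b)] of the domain of [K] over the base of [U] have [a] and [b] in the
    same fibre of [X] with the same image in [T], so one needs [w] to be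
    injective on the fibres of [X]; by [point_mono] this may be tested over the
    base of [U], where [X] restricts to [U] and [w] to the monomorphism [v]. *)
Lemma extremal_mono (U X T : Pt E) (v : hom U T) (w : hom X T) (u : hom U X) :
  is_mono v -> is_extremal (@pt_cartesian E) v w u -> is_mono w.
Proof.
  intros Hv [ev [Hu Hex]].
  destruct (pt_mono_components lim Hv) as [_ Hvd].
  assert (evd : pth_dom w ∘ pth_dom u = pth_dom v) by (rewrite ev; reflexivity).
  assert (Hj : forall (z : E) (a b : hom z (pt_dom X)),
             pt_map X ∘ a = pt_map X ∘ b -> pth_dom w ∘ a = pth_dom w ∘ b -> a = b).
  { destruct (pb_lift lim (eq_sym (pth_map w))) as [m [m0 m1]].
    assert (Hm : is_mono m).
    { apply (point_mono (h := pth_base u) (p := X) m0).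
      intros z a b c ea eb eab.
      destruct (pullback_lift Hu ea) as [a' [<- ea']].
      destruct (pullback_lift Hu eb) as [b' [<- eb']].
      f_equal; apply Hvd; rewrite <- evd, <- m1, <- !comp_assoc, eab; reflexivity. }
    intros z a b e0 e1; apply Hm, pb_uniq; rewrite !comp_assoc.
    - rewrite m0; exact e0.
    - rewrite m1; exact e1. }
  destruct (pullback_lift (pt_pb_is_pullback lim w w) (eq_refl (w ∘ u)))
    as [d [d0 d1]].
  assert (dw := d0 : pt_pb_fst lim w w ∘ d = u).
  assert (dw' := d1 : pt_pb_snd lim w w ∘ d = u).
  assert (Hk : forall k : @hom (Pt E) (pt_pb lim w w) X, k ∘ d = u ->
             forall (z : E) x (y : hom z _), pt_map _ ∘ x = pth_base d ∘ y ->
             pt_map X ∘ (pth_dom k ∘ x) = pth_base u ∘ y).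
  { intros k <- z x y e; crw (pth_map k); rewrite e; apply comp_assoc. }
  assert (d0d := f_equal (@pth_dom _ _ _) d0 : pb_fst _ _ _ ∘ pth_dom d = pth_dom u).
  assert (d1d := f_equal (@pth_dom _ _ _) d1 : pb_snd _ _ _ ∘ pth_dom d = pth_dom u).
  clear d0 d1; assert (Hd : pt_cartesian d).
  { apply pullback_intro.
    - apply (pth_map d).
    - intros z s t e0 e1; apply (pullback_joint Hu); [|exact e1]; simpl in *.
      rewrite <- d0d, <- !comp_assoc, e0; reflexivity.
    - intros z x y exy.
      assert (ex0 := Hk _ dw z x y exy : _ ∘ (pb_fst _ _ _ ∘ x) = _).
      assert (ex1 := Hk _ dw' z x y exy : _ ∘ (pb_snd _ _ _ ∘ x) = _).
      assert (e01 : pb_fst _ _ _ ∘ x = pb_snd _ _ _ ∘ x).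
      { apply Hj; [congruence|]; rewrite !comp_assoc, pb_square; reflexivity. }
      destruct (pullback_lift Hu ex0) as [t [t0 t1]].
      exists t; split; [|exact t1]; apply pb_uniq; rewrite comp_assoc; simpl in *.
      + rewrite d0d; exact t0.
      + rewrite d1d, t0; exact e01. }
  apply (kernel_pair_mono (pt_pb_is_pullback lim w w)).
  destruct (Hex _ (w ∘ pt_pb_fst lim w w) d) as [t [_ Ht]]; [|exact Hd|].
  - rewrite <- comp_assoc, dw; exact ev.
  - transitivity t; [symmetry|]; apply Ht; split; auto.
    symmetry; apply (proj1 (pt_pb_is_pullback lim w w)).
Qed.

(** * Indiscrete relations as points *)

(** The indiscrete relation [X ×_Y X] on [p], computed in the fibre over [Y] and
    pointed over [X] by its first projection and the diagonal. *)
Definition nabla (Y : E) (p : point Y) : Pt E :=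
  PtOb (Point (pb_med_fst lim (eq_refl (pt_map p ∘ idm (pt_dom p))))).

Section NablaMap.
Variables (Y Y' : E) (p : point Y) (q : point Y') (b : hom Y Y')
  (x : hom (pt_dom p) (pt_dom q)) (e : pt_map q ∘ x = b ∘ pt_map p).

Lemma nabla_square :
  pt_map q ∘ (x ∘ pb_fst lim (pt_map p) (pt_map p)) =
  pt_map q ∘ (x ∘ pb_snd lim (pt_map p) (pt_map p)).
Proof. crw e; crw e; rewrite pb_square; reflexivity. Qed.

Definition nabla_map : @hom (Pt E) (nabla p) (nabla q).
Proof.
  exists x (pb_med lim nabla_square).
  - apply (pb_med_fst lim nabla_square).
  - apply pb_uniq; simpl; rewrite !comp_assoc, ?pb_med_fst, ?pb_med_snd;
      rewrite <- comp_assoc, ?pb_med_fst, ?pb_med_snd, comp_idl, comp_idr;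
      reflexivity.
Defined.
Lemma nabla_map_mono : is_mono x -> is_mono nabla_map.
Proof.
  intros Hx; apply (pt_mono_intro (f := nabla_map)); [exact Hx|].
  intros z a c eac; apply pb_uniq; apply Hx.
  - rewrite !comp_assoc, <- (pb_med_fst lim nabla_square), <- !comp_assoc.
    f_equal; exact eac.
  - rewrite !comp_assoc, <- (pb_med_snd lim nabla_square), <- !comp_assoc.
    f_equal; exact eac.
Qed.

Lemma nabla_map_cartesian :
  is_pullback x (pt_map p) (pt_map q) b -> pt_cartesian nabla_map.
Proof.
  intros Hx; apply pullback_intro; [exact (pth_map nabla_map)| |]; simpl.
  - intros z s t est est0; apply pb_uniq; [exact est0|].
    apply (pullback_joint Hx).
    + rewrite !comp_assoc, <- (pb_med_snd lim nabla_square), <- !comp_assoc.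
      rewrite est; reflexivity.
    + rewrite !comp_assoc, <- pb_square, <- !comp_assoc, est0; reflexivity.
  - intros z a c eac.
    assert (ed : pt_map q ∘ (pb_snd lim (pt_map q) (pt_map q) ∘ a)
                 = b ∘ (pt_map p ∘ c)).
    { rewrite comp_assoc, <- pb_square, <- comp_assoc, eac, !comp_assoc, e.
      reflexivity. }
    destruct (pullback_lift Hx ed) as [d [d1 d2]].
    destruct (pb_lift lim (eq_sym d2)) as [t [t1 t2]].
    exists t; split; [|exact t1].
    apply pb_uniq; rewrite comp_assoc.
    + rewrite (pb_med_fst lim nabla_square), <- comp_assoc, t1; auto.
    + rewrite (pb_med_snd lim nabla_square), <- comp_assoc, t2; auto.
Qed.
End NablaMap.

(** A pair of elements of [P] is a pair of elements of the pullback whose images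
    in [YP] agree; they agree as soon as their images in [YB] do, because [bb]
    is monic. *)
Lemma nabla_pullback (YP YA YB YT : E)
    (P : point YP) (A : point YA) (B : point YB) (T : point YT)
    (ba : hom YP YA) (bb : hom YP YB) (bf : hom YA YT) (bg : hom YB YT)
    (a : hom (pt_dom P) (pt_dom A)) (b : hom (pt_dom P) (pt_dom B))
    (f : hom (pt_dom A) (pt_dom T)) (g : hom (pt_dom B) (pt_dom T))
    (ea : pt_map A ∘ a = ba ∘ pt_map P) (eb : pt_map B ∘ b = bb ∘ pt_map P)
    (ef : pt_map T ∘ f = bf ∘ pt_map A) (eg : pt_map T ∘ g = bg ∘ pt_map B) :
  is_mono bb -> is_pullback a b f g ->
  is_pullback (nabla_map ea) (nabla_map eb) (nabla_map ef) (nabla_map eg).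
Proof.
  intros Hbb H; apply pt_pullback_intro; [exact H|]; simpl.
  assert (a0 := pb_med_fst lim (nabla_square ea)).
  assert (a1 := pb_med_snd lim (nabla_square ea)).
  assert (b0 := pb_med_fst lim (nabla_square eb)).
  assert (b1 := pb_med_snd lim (nabla_square eb)).
  assert (f0 := pb_med_fst lim (nabla_square ef)).
  assert (f1 := pb_med_snd lim (nabla_square ef)).
  assert (g0 := pb_med_fst lim (nabla_square eg)).
  assert (g1 := pb_med_snd lim (nabla_square eg)).
  apply pullback_intro.
  - apply pb_uniq; rewrite !comp_assoc, ?f0, ?f1, ?g0, ?g1, <- !comp_assoc;
      rewrite ?a0, ?a1, ?b0, ?b1, !comp_assoc, (proj1 H); reflexivity.
  - intros z s t e1 e2; apply pb_uniq; apply (pullback_joint H); rewrite !comp_assoc.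
    + rewrite <- a0, <- !comp_assoc, e1; reflexivity.
    + rewrite <- b0, <- !comp_assoc, e2; reflexivity.
    + rewrite <- a1, <- !comp_assoc, e1; reflexivity.
    + rewrite <- b1, <- !comp_assoc, e2; reflexivity.
  - intros z x y e.
    assert (e0 : f ∘ (pb_fst lim _ _ ∘ x) = g ∘ (pb_fst lim _ _ ∘ y))
      by (rewrite !comp_assoc, <- f0, <- g0, <- !comp_assoc, e; reflexivity).
    assert (e1 : f ∘ (pb_snd lim _ _ ∘ x) = g ∘ (pb_snd lim _ _ ∘ y))
      by (rewrite !comp_assoc, <- f1, <- g1, <- !comp_assoc, e; reflexivity).
    destruct (pullback_lift H e0) as [t0 [t00 t01]].
    destruct (pullback_lift H e1) as [t1 [t10 t11]].
    assert (et : pt_map P ∘ t0 = pt_map P ∘ t1).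
    { apply Hbb; rewrite !comp_assoc, <- eb, <- !comp_assoc, t01, t11.
      rewrite !comp_assoc, pb_square; reflexivity. }
    destruct (pb_lift lim et) as [t [ta tb]]; exists t.
    split; apply pb_uniq; rewrite comp_assoc, ?a0, ?a1, ?b0, ?b1;
      rewrite <- comp_assoc, ?ta, ?tb; assumption.
Qed.

Lemma fib_square (Y : E) (p q : point Y) (u : fib_hom p q) :
  pt_map q ∘ fib_dom u = idm Y ∘ pt_map p.
Proof. rewrite comp_idl; apply fib_map. Qed.

Definition nabla_fib (Y : E) (p q : point Y) (u : fib_hom p q) :
  @hom (Pt E) (nabla p) (nabla q) := nabla_map (fib_square u).

Definition bc_proj (Y Y' : E) (h : hom Y' Y) (p : point Y) :
  hom (pt_dom (bc_ob lim h p)) (pt_dom p) := pb_fst lim (pt_map p) h.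

Lemma bc_proj_pullback (Y Y' : E) (h : hom Y' Y) (p : point Y) :
  is_pullback (bc_proj h p) (pt_map (bc_ob lim h p)) (pt_map p) h.
Proof. apply pb_is_pullback. Qed.

Definition nabla_bc (Y Y' : E) (h : hom Y' Y) (p : point Y) :
  @hom (Pt E) (nabla (bc_ob lim h p)) (nabla p) :=
  nabla_map (proj1 (bc_proj_pullback h p)).

(** Hence decompositions over [nabla p] may be pulled back along [nabla_bc]. *)
Lemma nabla_bc_cartesian (Y Y' : E) (h : hom Y' Y) (p : point Y) :
  pt_cartesian (nabla_bc h p).
Proof. apply nabla_map_cartesian, bc_proj_pullback. Qed.

Section BaseChange.
Variables (Y Y' : E) (h : hom Y' Y) (p q : point Y) (u : fib_hom p q).
Let u' : fib_hom (bc_ob lim h p) (bc_ob lim h q) := bc_hom lim h u.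

Lemma bc_square : fib_dom u ∘ bc_proj h p = bc_proj h q ∘ fib_dom u'.
Proof. symmetry; apply (pb_med_fst lim (bc_dom_square lim h u)). Qed.

(** Injectivity of [u] over [Y'] is injectivity of [u'], so [point_mono]
    applies. *)
Lemma bc_mono_reflect : is_mono (fib_dom u') -> is_mono (fib_dom u).
Proof.
  intros Hu; apply (point_mono (h := h) (fib_map u)).
  intros z a b c ea eb eab.
  destruct (pullback_lift (bc_proj_pullback h p) ea) as [a' [a1 a2]].
  destruct (pullback_lift (bc_proj_pullback h p) eb) as [b' [b1 b2]].
  rewrite <- a1, <- b1; f_equal; apply Hu.
  apply (pullback_joint (bc_proj_pullback h q)); rewrite !comp_assoc.
  - rewrite <- bc_square, <- !comp_assoc, a1, b1; exact eab.
  - rewrite (fib_map u'), a2, b2; reflexivity.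
Qed.

Lemma bc_pullback :
  is_pullback (bc_proj h p) (fib_dom u') (fib_dom u) (bc_proj h q).
Proof.
  apply pullback_intro; [exact bc_square| |].
  - intros z s t e1 e2; apply (pullback_joint (bc_proj_pullback h p)); [exact e1|].
    rewrite <- (fib_map u'), <- !comp_assoc, e2; reflexivity.
  - intros z a b e.
    assert (ea : pt_map p ∘ a = h ∘ (pt_map (bc_ob lim h q) ∘ b)).
    { rewrite <- (fib_map u), <- comp_assoc, e, !comp_assoc.
      rewrite (proj1 (bc_proj_pullback h q)); reflexivity. }
    destruct (pullback_lift (bc_proj_pullback h p) ea) as [t [t1 t2]].
    exists t; split; [exact t1|].
    apply (pullback_joint (bc_proj_pullback h q)); rewrite comp_assoc.
    + rewrite <- bc_square, <- comp_assoc, t1; exact e.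
    + rewrite (fib_map u'); exact t2.
Qed.

Lemma nabla_bc_pullback :
  is_pullback (nabla_bc h p) (nabla_fib u') (nabla_fib u) (nabla_bc h q).
Proof.
  apply nabla_pullback; [|exact bc_pullback].
  intros z s t; rewrite !comp_idl; auto.
Qed.
End BaseChange.

(** * Normal monomorphisms and decompositions *)

(** The object [A] is the relation to which [u] is normal, seen as a point over
    [X] by its first projection and its reflexivity; the discrete fibration
    becomes the cartesian map [c].  The base of [A] is then [X] itself, which
    is what the section [s] records. *)
Lemma normal_decomposition (Y : E) (U X : PtFib Y) (u : hom U X) :
  is_normal_mono u ->
  exists (A : Pt E) (r : hom A (nabla X)) (c : hom (nabla U) A)
    (s : hom (pt_dom X) (pt_base A)),
    nabla_fib u = r ∘ c /\ pt_cartesian c /\ pth_base r ∘ s = idm (pt_dom X).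
Proof.
  intros [_ [R [d0 [d1 [[Hj Hr] [UU [p0 [p1 [k [Hprod [[ek0 [ek1 _]] Hpb]]]]]]]]]]].
  destruct (equiv_refl _ _ (Hr X) (idm X)) as [e [e0 e1]].
  assert (fd := fun (p q r : PtFib Y) (g : hom q r) (f : hom p q) (k : hom p r)
                  (H : g ∘ f = k) =>
                  f_equal (@fib_dom _ _ _ _) H : fib_dom g ∘ fib_dom f = fib_dom k).
  assert (HUU := fib_product_dom lim Hprod).
  assert (HP := fib_pullback_dom lim Hpb).
  destruct (pullback_lift HUU (pb_square lim (pt_map U) (pt_map U))) as [j [j0 j1]].
  destruct (pb_lift lim (proj1 HUU)) as [i [i0 i1]].
  assert (eji : j ∘ i = idm _).
  { apply (pullback_joint HUU); rewrite comp_idr, comp_assoc.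
    - rewrite j0; exact i0.
    - rewrite j1; exact i1. }
  assert (eij : i ∘ j = idm _).
  { apply pb_uniq; rewrite comp_idr, comp_assoc.
    - rewrite i0; exact j0.
    - rewrite i1; exact j1. }
  set (A := PtOb (Point (fd _ _ _ _ _ _ e0)) : Pt E).
  assert (sq : pt_map X ∘ fib_dom d0 = pt_map X ∘ fib_dom d1)
    by (rewrite !fib_map; reflexivity).
  assert (rm : pt_map (nabla X) ∘ pb_med lim sq = idm _ ∘ pt_map A)
    by (rewrite comp_idl; apply (pb_med_fst lim sq)).
  assert (rs : pb_med lim sq ∘ pt_sec A = pt_sec (nabla X) ∘ idm _).
  { rewrite comp_idr; apply pb_uniq; simpl; rewrite comp_assoc.
    - rewrite !pb_med_fst; exact (fd _ _ _ _ _ _ e0).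
    - rewrite !pb_med_snd; exact (fd _ _ _ _ _ _ e1). }
  assert (k0 := f_equal (@fib_dom _ _ _ _) ek0 :
            fib_dom d0 ∘ fib_dom k = fib_dom u ∘ fib_dom p0).
  assert (k1 := f_equal (@fib_dom _ _ _ _) ek1 :
            fib_dom d1 ∘ fib_dom k = fib_dom u ∘ fib_dom p1).
  assert (cm : pt_map A ∘ (fib_dom k ∘ j) = fib_dom u ∘ pt_map (nabla U))
    by (simpl; rewrite comp_assoc, k0, <- comp_assoc, j0; reflexivity).
  assert (cs : (fib_dom k ∘ j) ∘ pt_sec (nabla U) = pt_sec A ∘ fib_dom u).
  { destruct (Hprod U (idm U) (idm U)) as [d [[d0' d1'] _]].
    assert (ed : e ∘ u = k ∘ d).
    { apply Hj; rewrite !comp_assoc.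
      - rewrite e0, ek0, <- comp_assoc, d0', comp_idl, comp_idr; reflexivity.
      - rewrite e1, ek1, <- comp_assoc, d1', comp_idl, comp_idr; reflexivity. }
    simpl; rewrite (fd _ _ _ _ _ _ ed : fib_dom e ∘ fib_dom u = _); simpl.
    rewrite <- comp_assoc; f_equal; apply (pullback_joint HUU); rewrite comp_assoc.
    - rewrite j0, pb_med_fst; symmetry; exact (fd _ _ _ _ _ _ d0').
    - rewrite j1, pb_med_snd; symmetry; exact (fd _ _ _ _ _ _ d1'). }
  exists A, (@PtHom E A (nabla X) _ _ rm rs), (@PtHom E (nabla U) A _ _ cm cs), (idm _).
  split; [|split; [|apply comp_idl]].
  - apply pt_hom_eq; simpl; [symmetry; apply comp_idl|].
    apply pb_uniq; rewrite ?comp_assoc, ?pb_med_fst, ?pb_med_snd.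
    + rewrite k0, <- comp_assoc, j0; reflexivity.
    + rewrite k1, <- comp_assoc, j1; reflexivity.
  - unfold pt_cartesian; simpl.
    apply pullback_sym; rewrite <- j0; exact (pullback_iso HP eij eji).
Qed.

(** Transporting [A] along the isomorphism [pth_base w] turns it into a
    reflexive relation [W] on [X], and [c] into a discrete fibration from the
    indiscrete relation of [U] to [W].  The relation is first shown to be an
    equivalence in the whole category and then restricted to the fibre. *)
Lemma decomposition_normal (Y : E) (U X : PtFib Y) (u : hom U X)
    (A : Pt E) (w : hom A (nabla X)) (c : hom (nabla U) A) :
  is_mono u -> is_mono w -> pt_cartesian c -> nabla_fib u = w ∘ c ->
  is_iso (pth_base w) -> is_normal_mono u.
Proof.
  intros Hu Hw Hc ewc [yi [_ ey2]]; split; [exact Hu|].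
  destruct (pt_mono_components lim Hw) as [Hy Hx].
  set (g := pt_map A); set (y := pth_base w : hom (pt_base A) (pt_dom X)).
  set (x := pth_dom w : hom (pt_dom A) (pb lim (pt_map X) (pt_map X))).
  set (k := pth_dom c : hom (pb lim (pt_map U) (pt_map U)) (pt_dom A)).
  set (d0 := pb_fst lim _ _ ∘ x); set (d1 := pb_snd lim _ _ ∘ x).
  set (e := pt_sec A ∘ yi).
  assert (ef : pt_map X ∘ d0 = pt_map X ∘ d1)
    by (unfold d0, d1; rewrite !comp_assoc, pb_square; reflexivity).
  assert (Hj : forall (z : E) (a b : hom z _),
             d0 ∘ a = d0 ∘ b -> d1 ∘ a = d1 ∘ b -> a = b).
  { unfold d0, d1; intros z a b e0 e1; rewrite <- !comp_assoc in e0, e1.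
    apply Hx, pb_uniq; assumption. }
  assert (d0y : d0 = y ∘ g) by apply (pth_map w).
  assert (e0 : d0 ∘ e = idm _).
  { rewrite d0y; unfold e, g; crw (pt_split A); rewrite comp_idl; exact ey2. }
  assert (e1 : d1 ∘ e = idm _).
  { unfold d1, e; rewrite <- comp_assoc, (comp_assoc x).
    rewrite (pth_sec w : x ∘ pt_sec A = pb_med lim _ ∘ y); simpl.
    rewrite <- comp_assoc, comp_assoc, pb_med_snd, comp_idl; exact ey2. }
  assert (ub : y ∘ pth_base c = fib_dom u)
    by (symmetry; exact (f_equal (@pth_base _ _ _) ewc)).
  assert (ud : x ∘ k = pb_med lim (nabla_square (fib_square u)))
    by (symmetry; exact (f_equal (@pth_dom _ _ _) ewc)).
  assert (k0 : d0 ∘ k = fib_dom u ∘ pb_fst lim (pt_map U) (pt_map U))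
    by (unfold d0; rewrite <- comp_assoc, ud; apply pb_med_fst).
  assert (k1 : d1 ∘ k = fib_dom u ∘ pb_snd lim (pt_map U) (pt_map U))
    by (unfold d1; rewrite <- comp_assoc, ud; apply pb_med_snd).
  assert (Hk : is_pullback k (pb_fst lim (pt_map U) (pt_map U)) d0 (fib_dom u)).
  { apply pullback_intro; [exact k0|exact (@pullback_joint _ _ _ _ _ _ _ _ _ Hc)|].
    intros z a b eab; apply (pullback_lift Hc); fold g.
    apply Hy; transitivity (d0 ∘ a).
    - rewrite d0y; apply comp_assoc.
    - rewrite eab, <- ub; symmetry; apply comp_assoc. }
  destruct (equivalence_along_discrete_fibration ef Hj e0 e1
    (kernel_pair_equivalence (pb_is_pullback lim (pt_map U) (pt_map U))) Hk k1)
    as [_ Hr].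
  assert (split : (pt_map X ∘ d0) ∘ (e ∘ pt_sec X) = idm Y)
    by (crw e0; rewrite comp_idl; apply pt_split).
  set (W := Point split : PtFib Y).
  assert (s0 : d0 ∘ pt_sec W = pt_sec X) by (simpl; crw e0; apply comp_idl).
  assert (s1 : d1 ∘ pt_sec W = pt_sec X) by (simpl; crw e1; apply comp_idl).
  set (D0 := @FibHom E Y W X d0 eq_refl s0 : @hom (PtFib Y) W X).
  set (D1 := @FibHom E Y W X d1 (eq_sym ef) s1 : @hom (PtFib Y) W X).
  set (t := fib_to_unit U).
  set (P0 := fib_pb_fst lim t t); set (P1 := fib_pb_snd lim t t).
  assert (km : pt_map W ∘ k = pt_map (fib_pb lim t t)).
  { simpl; rewrite <- comp_assoc, k0, comp_assoc, fib_map; reflexivity. }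
  assert (ks : k ∘ pt_sec (fib_pb lim t t) = pt_sec W).
  { apply Hj; rewrite comp_assoc.
    - rewrite s0, k0, <- comp_assoc; simpl; rewrite pb_med_fst; apply fib_sec.
    - rewrite s1, k1, <- comp_assoc; simpl; rewrite pb_med_snd; apply fib_sec. }
  set (K := @FibHom E Y (fib_pb lim t t) W k km ks : @hom (PtFib Y) (fib_pb lim t t) W).
  assert (HP := pb_is_pullback lim (pt_map U) (pt_map U)).
  assert (Hprod : is_product P0 P1).
  { intros z a b.
    apply (@fib_pullback_intro _ _ _ _ _ _ P0 P1 t t HP).
    apply fib_hom_eq; simpl; rewrite !fib_map; reflexivity. }
  assert (HjW : forall (z : PtFib Y) (a b : hom z W),
             D0 ∘ a = D0 ∘ b -> D1 ∘ a = D1 ∘ b -> a = b).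
  { intros z a b f0 f1; apply fib_hom_eq, Hj;
      [exact (f_equal (@fib_dom _ _ _ _) f0)|exact (f_equal (@fib_dom _ _ _ _) f1)]. }
  assert (K0 : D0 ∘ K = u ∘ P0) by (apply fib_hom_eq; exact k0).
  assert (K1 : D1 ∘ K = u ∘ P1) by (apply fib_hom_eq; exact k1).
  exists W, D0, D1; split; [split; [exact HjW|]|].
  (* A map into [X] of points related in the whole category is related in the
     fibre: joint monicity forces [r] to preserve the sections. *)
  - assert (Hfib : forall (z : PtFib Y) (a b : hom z X),
      (exists r : hom z W, D0 ∘ r = a /\ D1 ∘ r = b) <->
      (exists r : hom (pt_dom z) (pt_dom A), d0 ∘ r = fib_dom a /\ d1 ∘ r = fib_dom b)).
    { intros z a b; split.
      - intros [r [<- <-]]; exists (fib_dom r); auto.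
      - intros [r [r0 r1]].
        assert (rm : pt_map W ∘ r = pt_map z)
          by (simpl; rewrite <- comp_assoc, r0; apply fib_map).
        assert (rs : r ∘ pt_sec z = pt_sec W).
        { apply Hj; rewrite comp_assoc.
          - rewrite r0, s0; apply fib_sec.
          - rewrite r1, s1; apply fib_sec. }
        exists (@FibHom E Y z W r rm rs); split; apply fib_hom_eq; assumption. }
    intros z; specialize (Hr (pt_dom z)); constructor.
    + intros a; apply Hfib; apply (equiv_refl _ _ Hr).
    + intros a b d; rewrite !Hfib; apply (equiv_trans _ _ Hr).
    + intros a b; rewrite !Hfib; apply (equiv_sym _ _ Hr).
  - exists (fib_pb lim t t), P0, P1, K; split; [exact Hprod|split].
    + split; [exact K0|split; [exact K1|]]; intros z a b r r0 r1.
      destruct (Hprod z a b) as [s [[sa sb] su]].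
      exists s; split; [split; [exact sa|split; [exact sb|]]|].
      * apply HjW; rewrite comp_assoc.
        -- rewrite K0, <- comp_assoc, sa; auto.
        -- rewrite K1, <- comp_assoc, sb; auto.
      * intros s' [sa' [sb' _]]; apply su; auto.
    + apply fib_pullback_intro; apply pullback_sym; exact Hk.
Qed.
End Protomodular.

Theorem corollary5p2 (E : category) (lim : finitely_complete E)
  (dec : stably_decomposable E) (pm : protomodular lim) :
  strongly_protomodular lim.
Proof.
  split; [exact pm|]; intros Y' Y h U X u Hn.
  destruct dec as [Hdec Hstab].
  assert (Hu : is_mono (fib_dom u))
    by (apply (bc_mono_reflect pm (h := h)); apply (fib_mono_dom lim (proj1 Hn))).
  assert (Hv := nabla_map_mono (lim := lim) (e := fib_square u) Hu :
            is_mono (nabla_fib lim u)).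
  destruct (Hdec _ _ _ Hv) as [A [w [c Hex]]].
  assert (Hw := extremal_mono pm Hv Hex).
  assert (Hc := proj1 (proj2 Hex)); assert (evwc := proj1 Hex).
  apply (decomposition_normal pm (fib_mono_intro Hu) Hw Hc evwc).
  destruct (normal_decomposition lim Hn) as [A' [r [c' [s [er [Hc' es]]]]]].
  set (th := nabla_bc lim h X).
  assert (Hpb := pt_pb_is_pullback lim w th).
  assert (HpU := nabla_bc_pullback lim h u).
  assert (e1 : w ∘ (c ∘ nabla_bc lim h U) = th ∘ nabla_fib lim (bc_hom lim h u))
    by (rewrite comp_assoc, <- evwc; exact (proj1 HpU)).
  destruct (pullback_lift Hpb e1) as [d [d1 d2]].
  destruct (Hstab _ _ _ _ _ _ Hv Hex _ th (nabla_bc_cartesian lim h X)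
              _ _ _ _ _ _ d HpU Hpb d2 d1) as [_ [_ Hmax]].
  (* [r ∘ c'] is the decomposition of the pulled back monomorphism given by
     normality; compare it with the extremal one. *)
  destruct (Hmax _ r c' er Hc') as [t [[tr _] _]].
  assert (etr := f_equal (@pth_base _ _ _) tr :
            pb_snd lim (pth_base w) (pth_base th) ∘ pth_base t = pth_base r).
  destruct (pt_mono_components lim Hw) as [Hy _].
  apply (point_cover pm (h := h) (p := X) (s := pth_base c ∘ pt_sec U) Hy).
  - rewrite comp_assoc.
    assert (ub := f_equal (@pth_base _ _ _) evwc :
              fib_dom u = pth_base w ∘ pth_base c).
    transitivity (fib_dom u ∘ pt_sec U); [|apply fib_sec].
    exact (f_equal (fun k => k ∘ pt_sec U) (eq_sym ub)).
  - intros z a b eab; destruct (pb_lift lim eab) as [a' [ea _]].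
    assert (ets : pb_snd lim (pth_base w) (pth_base th) ∘ (pth_base t ∘ (s ∘ a'))
                  = a').
    { transitivity (pth_base r ∘ (s ∘ a')).
      - rewrite <- etr; apply comp_assoc.
      - transitivity (idm (pt_dom (base_change lim h X)) ∘ a'); [|apply comp_idl].
        rewrite <- es; apply comp_assoc. }
    exists (pb_fst lim (pth_base w) (pth_base th) ∘ (pth_base t ∘ (s ∘ a'))).
    rewrite comp_assoc, pb_square, <- comp_assoc, ets; exact ea.
Qed.
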